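(* Let $n\ge 7$ be an integer. Every connected graph $G$ of order $n$ and size at most $\lfloor 3n/2\rfloor$ has an independent minimum vertex cut. Moreover, the bound is best possible: for every integer $n\ge 7$ there exists a connected graph of order $n$ and size $\lfloor 3n/2\rfloor+1$ which has no independent minimum vertex cut.
   Context: All graphs are finite and simple. The order of a graph is its number of vertices and the size is its number of edges. A vertex cut of a connected graph $G$ is a set $S\subset V(G)$ such that $G-S$ is disconnected. If $G$ has connectivity $k$, a vertex cut $S$ is called minimum if $|S|=k$. A vertex cut $S$ is called an independent vertex cut if $S$ is an independent set of $G$. *)

(* Defs.v *)
From mathcomp Require Import all_boot.
Set Implicit Arguments. Unset Strict Implicit. Unset Printing Implicit Defensive.

Section Graph.
Variables (T : finType) (e : rel T).

Definition simple_graph : Prop := symmetric e /\ irreflexive e.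

Definition order : nat := #|T|.

Definition gsize : nat :=
  #|[set E : {set T} | [exists x, exists y, e x y && (E == [set x; y])]]|.

Definition gconnected : Prop := forall x y : T, connect e x y.

Definition del_rel (S : {set T}) : rel T :=
  [rel x y | [&& e x y, x \notin S & y \notin S]].

Definition vertex_cut (S : {set T}) : Prop :=
  exists x y : T, [/\ x \notin S, y \notin S & ~~ connect (del_rel S) x y].

Definition min_vertex_cut (S : {set T}) : Prop :=
  vertex_cut S /\ forall S' : {set T}, vertex_cut S' -> #|S| <= #|S'|.

Definition independent (S : {set T}) : Prop :=
  forall x y, x \in S -> y \in S -> ~~ e x y.

Definition has_indep_min_vertex_cut : Prop :=
  exists S : {set T}, min_vertex_cut S /\ independent S.

End Graph.

(* Main.v *)
Require Import Defs.
From mathcomp Require Import all_boot.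
From mathcomp Require Import zify.
From Stdlib Require Import Classical.

Set Implicit Arguments.
Unset Strict Implicit.
Unset Printing Implicit Defensive.

(* If G has no independent minimum cut, it has no independent cut with at most
   two vertices, so the two neighbours of a vertex of degree 2 are adjacent and
   deleting that vertex preserves this property. Deleting such vertices one by
   one changes 2m - 3n by -1 each time and ends at a triangle (2m - 3n = -3) or
   at a graph of minimum degree at least 3 (2m - 3n >= 0). For n >= 7 and
   2m <= 3n this forces G to be cubic. Then a 2-cut, being an edge, can be pushed
   along one side until it yields a cut vertex, so G is 3-connected. Either the
   neighbourhood of a vertex is an independent cut, or there is a triangle abc
   with further neighbours a', b', c'; one of {a, b', c'}, {a', b, c'},
   {a', b', c} is an independent cut unless a', b', c' are mutually adjacent,
   which would close up a component of order 6.

   For sharpness, glue one or two triangles (according to the parity of n) along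
   one edge of a Moebius ladder, a 3-connected cubic graph: the ends of that edge
   form the only cut with at most two vertices. *)

(** * Counting edges by an orientation *)

(** An arc is recovered from its unordered pair because [r] never holds both ways, so each edge is
    counted once, at its tail. *)
Lemma gsize_orientation (T : finType) (e r : rel T) :
  irreflexive r -> (forall x y, r x y -> ~~ r y x) ->
  (forall x y, e x y = r x y || r y x) ->
  gsize e = \sum_x #|[set y | r x y]|.
Proof.
move=> rI rA eE.
pose P := [set p : T * T | r p.1 p.2].
have -> : gsize e = #|[set [set p.1; p.2] | p in P]|.
  apply: eq_card => E; rewrite inE; apply/idP/imsetP.
    move=> /existsP[x /existsP[y /andP[]]]; rewrite eE => /orP[rxy|ryx] /eqP ->.
      by exists (x, y); rewrite ?inE.
    by exists (y, x); rewrite ?inE // setUC.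
  case=> -[x y]; rewrite inE /= => rxy ->.
  by apply/existsP; exists x; apply/existsP; exists y; rewrite eE rxy eqxx.
rewrite card_in_imset.
  rewrite -sum1_card (eq_bigl (fun p => true && r p.1 p.2)); last by move=> p; rewrite inE.
  rewrite -(pair_big_dep predT r (fun _ _ => 1)) /=.
  by apply: eq_bigr => x _; rewrite -sum1_card; apply: eq_bigl => y; rewrite inE.
move=> [x y] [x' y']; rewrite !inE /= => rxy rxy' E.
have : x \in [set x'; y'] by rewrite -E set21.
have : y \in [set x'; y'] by rewrite -E set22.
case/set2P=> Ey /set2P[] Ex; subst x y => //.
- by rewrite rI in rxy.
- by move: (rA _ _ rxy); rewrite rxy'.
- by rewrite rI in rxy.
Qed.

(** * Separations and degree sums inside a vertex set *)

Section Graph.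
Variables (T : finType) (e : rel T).
Implicit Types (W S C : {set T}) (x y : T).

(** [C] is a union of components of the subgraph induced on [W] minus [S], nonempty and not all of
    it. Carrying [W] lets vertices be deleted without changing the type. *)
Definition separation W S C :=
  [/\ C != set0, C \subset W :\: S, ~~ (W \subset C :|: S)
    & forall a b, a \in C -> b \in W -> e a b -> b \in C :|: S].

Lemma vertex_cutP S : vertex_cut e S <-> exists C, separation setT S C.
Proof.
split=> [[x [y [xS yS nc]]]|[C [/set0Pn[x xC] sC nT cl]]].
  have sC z : connect (del_rel e S) x z -> z \notin S.
    move=> /connectP[p]; elim/last_ind: p z => [|p w _] z /=; first by move=> _ ->.
    by rewrite rcons_path last_rcons => /andP[_ /and3P[_ _ ?]] ->.
  exists [set z | connect (del_rel e S) x z]; split.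
  - by apply/set0Pn; exists x; rewrite inE connect0.
  - by apply/subsetP => z; rewrite !inE andbT => /sC.
  - by apply/subsetPn; exists y; rewrite // !inE (negbTE nc).
  move=> a b; rewrite !inE => xa _ ab.
  case: (boolP (b \in S)) => [|bS]; first by rewrite orbT.
  by rewrite orbF; apply: (connect_trans xa); apply: connect1; rewrite /del_rel /= ab (sC _ xa).
case/subsetPn: nT => y _; rewrite inE negb_or => /andP[yC yS].
exists x, y; split=> //; first by have := subsetP sC _ xC; rewrite inE => /andP[].
apply: contra yC => /connectP[p]; elim/last_ind: p y {yS} => [|p w IH] y /=.
  by move=> _ ->.
rewrite rcons_path last_rcons => /andP[pp /and3P[lw lS wS]] ->.
have := cl _ w (IH _ pp erefl) (in_setT _) lw.
by rewrite inE (negbTE wS) orbF.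
Qed.

(** In a loopless graph the empty set and singletons are independent, so this also makes the graph
    induced on [W] connected and free of cut vertices. *)
Definition good W := forall S C, independent e S -> #|S| <= 2 -> ~ separation W S C.

Definition nbrs W x := [set y in W | e x y].

Definition volume W := \sum_(x in W) #|nbrs W x|.

Hypotheses (eS : symmetric e) (eI : irreflexive e).

Lemma edge_neq x y : e x y -> x != y.
Proof. by apply: contraTneq => ->; rewrite eI. Qed.

Lemma independent_card1 S : #|S| <= 1 -> independent e S.
Proof. by move=> /card_le1_eqP S1 x y xS yS; rewrite (S1 _ _ xS yS) eI. Qed.

Lemma independent_set2 x y : ~~ e x y -> independent e [set x; y].
Proof.
by move=> nxy a b /set2P[] -> /set2P[] ->; rewrite ?eI // eS.
Qed.

Lemma card_nbrs_sum W x : #|nbrs W x| = \sum_(y in W) e x y.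
Proof.
rewrite -sum1_card (eq_bigl (fun y => (y \in W) && e x y)).
  by rewrite big_mkcondr; apply: eq_bigr => y _; case: (e x y).
by move=> y; rewrite inE.
Qed.

Lemma volume_setD1 W v :
  v \in W -> volume W = volume (W :\ v) + 2 * #|nbrs W v|.
Proof.
move=> vW; rewrite /volume (big_setD1 v) //=.
have -> : \sum_(x in W :\ v) #|nbrs W x| =
          \sum_(x in W :\ v) #|nbrs (W :\ v) x| + \sum_(x in W :\ v) e v x.
  rewrite -big_split /=; apply: eq_bigr => x _.
  by rewrite !card_nbrs_sum (big_setD1 v) //= eS addnC.
by rewrite !card_nbrs_sum (big_setD1 v) //= eI; lia.
Qed.

Lemma volume_gsize : volume setT = 2 * gsize e.
Proof.
pose r x y := e x y && (enum_rank x < enum_rank y).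
rewrite (@gsize_orientation _ e r).
- rewrite mul2n -addnn.
  have -> : \sum_x #|[set y | r x y]| = \sum_x \sum_y (r x y : nat).
    apply: eq_bigr => x _; rewrite -sum1_card (eq_bigl (r x)); last by move=> y; rewrite inE.
    by rewrite big_mkcond; apply: eq_bigr => y _; case: (r x y).
  rewrite {2}exchange_big /= -big_split /= /volume.
  apply: eq_big => [x|x _]; first by rewrite inE.
  rewrite card_nbrs_sum -big_split /=; apply: eq_big => [y|y _]; first by rewrite inE.
  rewrite /r (eS y x); case exy: (e x y) => //=.
  have := edge_neq exy; rewrite -(inj_eq enum_rank_inj) -val_eqE /=.
  by case: ltngtP.
- by move=> x; rewrite /r eI.
- by move=> x y /andP[_ xy]; rewrite /r negb_and -leqNgt (ltnW xy) orbT.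
move=> x y; rewrite /r (eS y x); case exy: (e x y) => //=.
have := edge_neq exy; rewrite -(inj_eq enum_rank_inj) -val_eqE /=.
by case: ltngtP.
Qed.

(** * Deleting a vertex of degree two *)

Lemma separation_nbrs W v :
  v \in W -> #|nbrs W v|.+1 < #|W| -> separation W (nbrs W v) [set v].
Proof.
move=> vW dv; split.
- by apply/set0Pn; exists v; rewrite inE.
- by rewrite sub1set !inE eI vW andbF.
- apply: contraL dv => /subset_leq_card sW; rewrite -leqNgt (leq_trans sW) //.
  by rewrite (leq_trans (leq_card_setU _ _)) // cards1.
by move=> a b /set1P-> bW vb; rewrite !inE bW vb orbT.
Qed.

Lemma good_degree W v : good W -> 3 <= #|W| -> v \in W -> 2 <= #|nbrs W v|.
Proof.
move=> gW W3 vW; rewrite leqNgt; apply/negP => dv.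
apply: (gW (nbrs W v) [set v]); [exact: independent_card1 | lia |].
by apply: separation_nbrs => //; lia.
Qed.

(** A separation of [W :\ v] lifts to [W]: the two neighbours of [v] are adjacent, so they never lie
    on opposite sides, and a [v] outside [S] joins [C] exactly when one of them is in [C]. *)
Lemma good_setD1 W v :
  good W -> 4 <= #|W| -> v \in W -> #|nbrs W v| = 2 -> good (W :\ v).
Proof.
move=> gW W4 vW dv S C iS S2 [nC sC nW cl].
have /cards2P[u [w [nuw Nv]]] : #|nbrs W v| == 2 by rewrite dv.
have euw : e u w.
  (* A nonadjacent pair [u], [w] would be an independent cut isolating [v]. *)
  apply/negPn/negP => nuw'; apply: (gW (nbrs W v) [set v]).
  - by rewrite Nv; apply: independent_set2.
  - by rewrite dv.
  by apply: separation_nbrs => //; lia.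
have [uW euv] : u \in W /\ e v u by have := set21 u w; rewrite -Nv inE => /andP.
have [wW ewv] : w \in W /\ e v w by have := set22 u w; rewrite -Nv inE => /andP.
have nvC : v \notin C by apply/negP => /(subsetP sC); rewrite !inE eqxx andbF.
have uw a : a \in W -> e v a -> a = u \/ a = w.
  by move=> aW va; apply/set2P; rewrite -Nv inE aW.
have [/orP uwC|] := boolP ((u \in C) || (w \in C)).
  have cS x y : (x \in C) -> y \in W -> v != y -> e x y -> y \in C :|: S.
    by move=> xC yW nvy; apply: cl; rewrite // !inE eq_sym nvy.
  case: (boolP (v \in S)) => vS.
    apply: (gW S C) => //; split=> //.
    + by apply: subset_trans sC _; rewrite setSD // subD1set.
    + by apply: contra nW => sW; apply: subset_trans sW; rewrite subD1set.
    move=> a b aC bW ab; case: (eqVneq v b) => [<-|nvb]; last exact: cS ab.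
    by rewrite inE vS orbT.
  apply: (gW S (v |: C)) => //; split.
  - by apply/set0Pn; exists v; rewrite setU11.
  - rewrite subUset sub1set inE vS vW; apply: subset_trans sC _.
    by rewrite setSD // subD1set.
  - apply: contra nW => sW; apply/subsetP => a /setD1P[nav /(subsetP sW)].
    by rewrite !inE (negbTE nav).
  move=> a b /setU1P[->|aC] bW ab; rewrite -setUA; apply/setU1P.
    right; have [uC|uC] := boolP (u \in C).
      case: (uw b bW ab) => ->; first by rewrite inE uC.
      by apply: (cS u) => //; apply: edge_neq.
    case: uwC => [|wC]; first by rewrite (negbTE uC).
    case: (uw b bW ab) => ->; last by rewrite inE wC.
    by apply: (cS w) => //; [apply: edge_neq | rewrite eS].
  by case: (eqVneq v b) => [<-|nvb]; [left | right; apply: cS ab].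
rewrite negb_or => /andP[uC wC].
apply: (gW S C) => //; split=> //.
+ by apply: subset_trans sC _; rewrite setSD // subD1set.
+ by apply: contra nW => sW; apply: subset_trans sW; rewrite subD1set.
move=> a b aC bW ab; apply: (cl a) => //; rewrite !inE bW andbT.
apply: contraTneq ab => ->; rewrite eS; apply/negP => va.
have aW : a \in W by have := subsetP sC _ aC; rewrite !inE => /and3P[].
by case: (uw a aW va) aC => ->; apply/negP.
Qed.

(* Stripping a vertex of degree 2 keeps [good] and lowers
   [volume W - 3 * #|W|] by 1; this stops either at a triangle or at a graph
   of minimum degree at least 3. *)
Lemma good_volume W : good W -> 3 <= #|W| ->
  4 * #|W| <= volume W + 6 \/
  3 * #|W| <= volume W /\
    forall v, v \in W -> #|nbrs W v| = 2 -> 3 * #|W| < volume W.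
Proof.
move=> gW W3; have [n leWn] := ubnP #|W|.
elim: n W gW W3 leWn => // n IH W gW W3 leWn.
have min_deg2 v := @good_degree W v gW W3.
have volW k : (forall v, v \in W -> k <= #|nbrs W v|) -> k * #|W| <= volume W.
  by move=> le_k; rewrite mulnC -sum_nat_const; apply: leq_sum.
have [W4|] := leqP 4 #|W|; last by left; have := volW 2 min_deg2; lia.
have [/existsP[v /andP[vW /eqP dv]]|no2] := boolP [exists v in W, #|nbrs W v| == 2].
  have Wv := cardsD1 v W; rewrite vW in Wv.
  have := volume_setD1 vW; rewrite dv => Vv.
  have [] := IH (W :\ v) (good_setD1 gW W4 vW dv); try lia.
  by move=> [le _]; right; split=> [|_ _ _]; lia.
right; split=> [|v vW dv].
  apply: volW => v vW; rewrite ltn_neqAle min_deg2 // andbT eq_sym.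
  by apply: contraNN no2 => dv; apply/existsP; exists v; rewrite vW.
by case/negP: no2; apply/existsP; exists v; rewrite vW dv /=.
Qed.

Lemma good_cubic :
  good setT -> 7 <= #|T| -> 2 * gsize e <= 3 * #|T| ->
  forall v, #|nbrs setT v| = 3.
Proof.
move=> gT T7 m_le; rewrite -volume_gsize in m_le.
have T3 : 3 <= #|[set: T]| by rewrite cardsT; lia.
(* The first alternative gives [4 * #|T| <= 3 * #|T| + 6], excluded by [7 <= #|T|]. *)
have [] := good_volume gT T3; rewrite cardsT; first lia.
move=> [vol_ge no2].
have deg3 v : 3 <= #|nbrs setT v|.
  rewrite ltn_neqAle (good_degree gT) ?inE // andbT eq_sym.
  by apply/eqP => /no2; rewrite inE => /(_ isT); lia.
move=> v; apply/eqP; rewrite eqn_leq deg3 andbT leqNgt; apply/negP => dv.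
have : 3 * #|T| < volume setT.
  have sum_ge : \sum_(x in [set: T] :\ v) 3 <= \sum_(x in [set: T] :\ v) #|nbrs setT x|.
    by apply: leq_sum => x _.
  rewrite sum_nat_const in sum_ge.
  rewrite /volume (big_setD1 v) ?inE //=.
  move: sum_ge (cardsD1 v setT); rewrite cardsT in_setT /=.
  by move: (\sum_(i in _) _) => s; lia.
lia.
Qed.

(** * Three-connectivity in the cubic case *)

Lemma separation_compl S C :
  separation setT S C -> separation setT S (~: (C :|: S)).
Proof.
move=> [nC sC nT cl]; have CS a : a \in C -> a \notin S.
  by move/(subsetP sC); rewrite inE => /andP[].
split.
- by case/subsetPn: nT => x _ nx; apply/set0Pn; exists x; rewrite inE.
- by apply/subsetP => a; rewrite !inE negb_or => /andP[_ ->].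
- case/set0Pn: nC => x xC; apply/subsetPn; exists x; rewrite ?inE //.
  by rewrite xC (negbTE (CS _ xC)).
move=> a b; rewrite !inE => nab _ ab; rewrite negb_or.
case: (boolP (b \in S)) => bS; first by rewrite orbT.
rewrite orbF andbT; apply: contra nab => bC.
by have := cl b a bC (in_setT _); rewrite eS ab inE => /(_ isT).
Qed.

Hypothesis gT : good setT.
Hypothesis cubic : forall v, #|nbrs setT v| = 3.

Lemma cubic_nbrs4 v a b c d :
  e v a -> e v b -> e v c -> e v d -> ~~ uniq [:: a; b; c; d].
Proof.
move=> ea eb ec ed; apply/negP => u4.
have : #|[:: a; b; c; d]| <= #|nbrs setT v|.
  apply: subset_leq_card; apply/subsetP => x; rewrite !inE.
  by case/or4P=> /eqP ->.
by rewrite (card_uniqP u4) cubic.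
Qed.

Lemma cubic_nbrs3 v a b c z :
  e v a -> e v b -> e v c -> uniq [:: a; b; c] -> e v z -> z \in [:: a; b; c].
Proof.
move=> va vb vc u3 vz; have := cubic_nbrs4 vz va vb vc.
by rewrite cons_uniq u3 andbT negbK.
Qed.

(* If [x] had no neighbour in [C], then [y] alone would separate [C]. *)
Lemma cut2_nbr x y C :
  separation setT [set x; y] C -> exists2 a, a \in C & e x a.
Proof.
move=> [nC sC nT cl]; apply/exists_inP; case: (boolP [exists _ in _, _]) => // /exists_inPn nx.
exfalso; apply: (gT (S := [set y]) (C := C)); rewrite ?cards1 //.
  by apply: independent_card1; rewrite cards1.
have CS a : a \in C -> a \notin [set x; y].
  by move/(subsetP sC); rewrite inE => /andP[].
split=> //.
- apply/subsetP => a /CS; rewrite !inE negb_or andbT.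
  by case/andP.
- by apply: contra nT => /subset_trans; apply; rewrite setUS // subsetUr.
move=> a b aC bT ab; have := cl a b aC bT ab; rewrite !inE.
case/or3P=> [->|/eqP bx|->]; rewrite ?orbT //.
by have := nx a aC; rewrite eS -bx ab.
Qed.

Lemma cubic_no_cut2 S C : #|S| <= 2 -> ~ separation setT S C.
Proof.
move=> S2 sepC.
have nS : ~ independent e S by move=> iS; apply: (gT iS S2 sepC).
have S2' : #|S| == 2.
  by rewrite eqn_leq S2 ltnNge; apply/negP => /independent_card1.
have /cards2P[x [y [nxy ES]]] := S2'; subst S.
have exy : e x y by apply/negPn/negP => /independent_set2.
have eyx : e y x by rewrite eS.
have sepC' : separation setT [set y; x] C by rewrite setUC.
have sepD := separation_compl sepC.
have sepD' := sepD; rewrite {1}setUC in sepD'.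
have [a aC xa] := cut2_nbr sepC.
have [b bC yb] := cut2_nbr sepC'.
have [c cD xc] := cut2_nbr sepD.
have [d dD yd] := cut2_nbr sepD'.
case: (sepC) => _ sC _ cl.
have CS z : z \in C -> (z != x) && (z != y).
  by move/(subsetP sC); rewrite !inE andbT negb_or.
have DC z w : z \in C -> w \in ~: (C :|: [set x; y]) -> (z != w) && (x != w) && (y != w).
  move=> zC; rewrite !inE !negb_or => /and3P[wC wx wy].
  by rewrite (eq_sym x) wx (eq_sym y) wy !andbT; apply: contraNneq wC => <-.
(* The vertex [y], the neighbour [a] in [C] and the neighbour [c] on the far side exhaust the three
   neighbours of [x]. *)
have ux z : z \in C -> e x z -> z = a.
  move=> zC xz; apply/eqP/negPn/negP => nza.
  have /negP[] := cubic_nbrs4 exy xz xa xc.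
  have /andP[/andP[h1 h2] h3] := DC _ _ zC cD; have /andP[/andP[h4 _] _] := DC _ _ aC cD.
  have /andP[_ h5] := CS _ zC; have /andP[_ h6] := CS _ aC.
  by rewrite /= !inE !negb_or (eq_sym y z) (eq_sym y a) h1 h3 h4 h5 h6 nza.
have uy z : z \in C -> e y z -> z = b.
  move=> zC yz; apply/eqP/negPn/negP => nzb.
  have /negP[] := cubic_nbrs4 eyx yz yb yd.
  have /andP[/andP[h1 h2] h3] := DC _ _ zC dD; have /andP[/andP[h4 _] _] := DC _ _ bC dD.
  have /andP[h5 _] := CS _ zC; have /andP[h6 _] := CS _ bC.
  by rewrite /= !inE !negb_or (eq_sym x z) (eq_sym x b) h1 h2 h4 h5 h6 nzb.
have /andP[nax nay] := CS _ aC.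
(* If [C] were just [a], all three neighbours of [a] would lie in the two-element cut. *)
have nC' : C :\ a != set0.
  apply/eqP => C0; have: nbrs setT a \subset [set x; y].
    apply/subsetP => z; rewrite inE => /andP[zT az]; have := cl _ _ aC zT az.
    rewrite inE => /orP[zC|//]; have : z \in C :\ a.
      by rewrite !inE zC eq_sym edge_neq.
    by rewrite C0 inE.
  by move/subset_leq_card; rewrite cubic cards2; case: (_ != _).
(* Being the only neighbour of [x] in [C], the vertex [a] can replace [x] in the cut, with a smaller
   side. *)
have sepa : separation setT [set a; y] (C :\ a).
  split=> //.
  - apply/subsetP => z /setD1P[nza /CS /andP[_ nzy]].
    by rewrite !inE negb_or nza nzy.
  - apply/subsetPn; exists x; rewrite // !inE (eq_sym x a) (negbTE nax) (negbTE nxy).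
    by rewrite /= orbF; apply/negP => /CS; rewrite eqxx.
  move=> z w /setD1P[nza zC] wT zw; have := cl z w zC wT zw; rewrite !inE.
  case: (eqVneq w a) => //= nwa /or3P[-> //|/eqP wx|->]; last by rewrite orbT.
  by case/eqP: nza; apply: ux => //; rewrite -wx eS.
have ay : e a y.
  apply/negPn/negP => /independent_set2 iay.
  by apply: (gT iay _ sepa); rewrite cards2; case: (_ != _).
have ab : a = b by apply: uy => //; rewrite eS.
(* Now [a] is also the only neighbour of [y] in [C], so it alone cuts off the rest of [C]. *)
apply: (gT (S := [set a]) (C := C :\ a)); rewrite ?cards1 //.
  by apply: independent_card1; rewrite cards1.
split=> //.
- by apply/subsetP => z /setD1P[nza _]; rewrite !inE nza.
- apply/subsetPn; exists x; rewrite // !inE (eq_sym x a) (negbTE nax) orbF /=.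
  by apply/negP => /CS; rewrite eqxx.
move=> z w /setD1P[nza zC] wT zw; have := cl z w zC wT zw; rewrite !inE.
case: (eqVneq w a) => //= nwa /or3P[-> //|/eqP wx|/eqP wy].
  by case/eqP: nza; apply: ux => //; rewrite -wx eS.
by case/eqP: nza; rewrite ab; apply: uy => //; rewrite -wy eS.
Qed.

(** * Independent 3-cuts around a triangle *)

Hypothesis T7 : 7 <= #|T|.

Lemma cubic_cut3_min S C :
  #|S| <= 3 -> separation setT S C -> min_vertex_cut e S.
Proof.
move=> S3 sepC; split; first by apply/vertex_cutP; exists C.
move=> S' /vertex_cutP[C' sepC']; rewrite (leq_trans S3) // ltnNge.
by apply/negP => S'2; apply: cubic_no_cut2 sepC'.
Qed.

Definition third_nbr v a b c :=
  [/\ c != a, c != b, e v c & forall z, e v z -> z \in [:: a; b; c]].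

Lemma third_nbrP v a b : a != b -> e v a -> e v b -> exists c, third_nbr v a b c.
Proof.
move=> nab va vb.
have /cards1P[c Ec] : #|nbrs setT v :\ a :\ b| == 1.
  have := cubic v; rewrite (cardsD1 a) (cardsD1 b (_ :\ a)) !inE va vb (eq_sym b) nab.
  by rewrite !add1n => -[->].
have : c \in nbrs setT v :\ a :\ b by rewrite Ec set11.
rewrite !inE => /and3P[ncb nca vc]; exists c; split=> // z vz; rewrite !inE.
case: (eqVneq z a) => //= nza; case: (eqVneq z b) => //= nzb.
by rewrite -in_set1 -Ec !inE nza nzb.
Qed.

Lemma third_nbrC v a b c : third_nbr v a b c -> third_nbr v b a c.
Proof.
move=> [ca cb vc N]; split=> // z /N; rewrite !inE.
by case/or3P=> ->; rewrite ?orbT.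
Qed.

Lemma setT_not_sub_seq (s : seq T) : size s < #|T| -> ~~ ([set: T] \subset [set x in s]).
Proof.
move=> s_lt; apply/negP => /subset_leq_card; rewrite cardsT cardsE.
by move/leq_trans => /(_ _ (card_size s)); lia.
Qed.

(** If the outer neighbours of [a] and [b] coincided, that vertex and [c] would cut off [a] and
    [b]. *)
Lemma outer_neq a b c a' b' :
  e a b -> e b c -> e a c -> third_nbr a b c a' -> third_nbr b a c b' -> a' != b'.
Proof.
move=> ab bc ac [na'b na'c aa' Na_] [nb'a nb'c bb' Nb_]; apply/eqP => E.
apply: (@cubic_no_cut2 [set a'; c] [set a; b]); first by rewrite cards2; case: (_ != _).
split.
- by apply/set0Pn; exists a; rewrite set21.
- apply/subsetP => z /set2P[] ->; rewrite !inE negb_or andbT.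
    by rewrite !edge_neq.
  by rewrite eq_sym na'b edge_neq.
- have := @setT_not_sub_seq [:: a; b; a'; c] (leq_trans (isT : 4 < 7) T7).
  apply: contra => /subset_trans; apply; apply/subsetP => z; rewrite !inE.
  by rewrite -!orbA.
move=> z w /set2P[] -> _.
  by move/Na_; rewrite !inE; case/or3P=> ->; rewrite ?orbT.
by move/Nb_; rewrite !inE E; case/or3P=> ->; rewrite ?orbT.
Qed.

(** The set [{a, b', c'}] cuts off [b] and [c]; [a] is adjacent to neither [b'] nor [c'] because its
    only outer neighbour [a'] differs from both. *)
Lemma outer_nonadj_cut a b c a' b' c' :
  e a b -> e b c -> e a c ->
  third_nbr a b c a' -> third_nbr b a c b' -> third_nbr c a b c' ->
  ~~ e b' c' -> has_indep_min_vertex_cut e.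
Proof.
move=> ab bc ac Na Nb Nc nb'c'.
have nab' : a' != b' := outer_neq ab bc ac Na Nb.
have nac' : a' != c'.
  by apply: (outer_neq ac _ ab (third_nbrC Na) Nc); rewrite eS.
have [na'b na'c aa' Na_] := Na; have [nb'a nb'c bb' Nb_] := Nb.
have [nc'a nc'b cc' Nc_] := Nc.
have nab : ~~ e a b'.
  apply/negP => /Na_; rewrite !inE (negbTE nb'c) eq_sym (negbTE (edge_neq bb')) /=.
  by rewrite eq_sym (negbTE nab').
have nac : ~~ e a c'.
  apply/negP => /Na_; rewrite !inE (negbTE nc'b) eq_sym (negbTE (edge_neq cc')) /=.
  by rewrite eq_sym (negbTE nac').
exists [set a; b'; c']; split; last first.
  move=> x y; rewrite !inE -!orbA => /or3P[] /eqP-> /or3P[] /eqP->; rewrite ?eI //.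
  - by rewrite eS.
  - by rewrite eS.
  - by rewrite eS.
apply: (@cubic_cut3_min _ [set b; c]).
  by rewrite (leq_trans (leq_card_setU _ _)) // cards1 cards2; case: (_ != _).
split.
- by apply/set0Pn; exists b; rewrite set21.
- apply/subsetP => z /set2P[] ->; rewrite !inE !negb_or andbT.
    by rewrite eq_sym edge_neq //= (edge_neq bb') eq_sym nc'b.
  by rewrite eq_sym edge_neq //= (edge_neq cc') eq_sym nb'c.
- have := @setT_not_sub_seq [:: b; c; a; b'; c'] (leq_trans (isT : 5 < 7) T7).
  apply: contra => /subset_trans; apply; apply/subsetP => z; rewrite !inE.
  by rewrite -!orbA.
move=> z w /set2P[] -> _.
  by move/Nb_; rewrite !inE; case/or3P=> ->; rewrite ?orbT.
by move/Nc_; rewrite !inE; case/or3P=> ->; rewrite ?orbT.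
Qed.

Lemma cubic_indep_min_cut : has_indep_min_vertex_cut e.
Proof.
have [v _] : exists v, v \in T by apply/card_gt0P; apply: leq_trans T7.
(* A neighbourhood without edges is an independent 3-cut isolating [v]. *)
have [|ind] := boolP [exists a in nbrs setT v, exists b in nbrs setT v, e a b]; last first.
  exists (nbrs setT v); split.
    apply: (@cubic_cut3_min _ [set v]); first by rewrite cubic.
    by apply: separation_nbrs; rewrite ?inE // cubic cardsT; lia.
  move=> x y xN yN; apply: contra ind => xy.
  by apply/exists_inP; exists x => //; apply/exists_inP; exists y.
case/exists_inP=> a; rewrite inE => /andP[_ va].
case/exists_inP=> b; rewrite inE => /andP[_ vb] ab.
have av : e a v by rewrite eS.
have bv : e b v by rewrite eS.
have ba : e b a by rewrite eS.
have [v' Nv] := third_nbrP (edge_neq ab) va vb.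
have [a' Na] := third_nbrP (edge_neq vb) av ab.
have [b' Nb] := third_nbrP (edge_neq va) bv ba.
(* One rotation of the triangle for each pair of outer neighbours. *)
have [a'b'|] := boolP (e a' b'); last exact: outer_nonadj_cut Nv Na Nb.
have [v'b'|] := boolP (e v' b'); last first.
  exact: outer_nonadj_cut av vb ab Na Nv (third_nbrC Nb).
have [v'a'|] := boolP (e v' a'); last first.
  exact: outer_nonadj_cut bv va ba Nb (third_nbrC Nv) (third_nbrC Na).
(* The triangle and its mutually adjacent outer neighbours are closed under adjacency, so with at
   least seven vertices the empty set is a cut. *)
exfalso.
have [nv'a nv'b vv' Nv_] := Nv; have [na'v na'b aa' Na_] := Na.
have [nb'v nb'a bb' Nb_] := Nb.
apply: (@cubic_no_cut2 set0 [set z in [:: v; a; b; v'; a'; b']]); first by rewrite cards0.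
split.
- by apply/set0Pn; exists v; rewrite !inE eqxx.
- by rewrite setD0 subsetT.
- by rewrite setU0; apply: setT_not_sub_seq.
have nv'a' : v' != a' := outer_neq va ab vb Nv Na.
have nv'b' : v' != b' := outer_neq vb ba va (third_nbrC Nv) Nb.
have na'b' : a' != b' := outer_neq ab bv av (third_nbrC Na) (third_nbrC Nb).
have Nv' z : e v' z -> z \in [:: v; a'; b'].
  apply: cubic_nbrs3; rewrite // 1?eS //.
  by rewrite /= !inE negb_or na'b' !(eq_sym v) na'v nb'v.
have Na' z : e a' z -> z \in [:: a; v'; b'].
  apply: cubic_nbrs3; rewrite // 1?eS //.
  by rewrite /= !inE negb_or nv'b' !(eq_sym a) nv'a nb'a.
have Nb' z : e b' z -> z \in [:: b; v'; a'].
  apply: cubic_nbrs3; rewrite // 1?eS //.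
  by rewrite /= !inE negb_or nv'a' !(eq_sym b) nv'b na'b.
have in6 := (inE, eqxx, orbT).
move=> x y; rewrite setU0 !in_set => + _.
rewrite [x \in _]inE => /predU1P[->|].
  by move/Nv_; apply: (allP (s := [:: _; _; _])); rewrite /= !in6.
rewrite [x \in _]inE => /predU1P[->|].
  by move/Na_; apply: (allP (s := [:: _; _; _])); rewrite /= !in6.
rewrite [x \in _]inE => /predU1P[->|].
  by move/Nb_; apply: (allP (s := [:: _; _; _])); rewrite /= !in6.
rewrite [x \in _]inE => /predU1P[->|].
  by move/Nv'; apply: (allP (s := [:: _; _; _])); rewrite /= !in6.
rewrite [x \in _]inE => /predU1P[->|].
  by move/Na'; apply: (allP (s := [:: _; _; _])); rewrite /= !in6.
rewrite mem_seq1 => /eqP ->.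
by move/Nb'; apply: (allP (s := [:: _; _; _])); rewrite /= !in6.
Qed.

End Graph.

(** * The bound for sparse graphs *)

Lemma vertex_cut_min (T : finType) (e : rel T) (S : {set T}) :
  vertex_cut e S -> exists2 S0, min_vertex_cut e S0 & #|S0| <= #|S|.
Proof.
have [n] := ubnP #|S|; elim: n S => // n IH S leSn cS.
have [[S' [cS' ltS']]|minS] := classic (exists S', vertex_cut e S' /\ #|S'| < #|S|).
  have [S0 m0 le0] := IH S' (leq_trans ltS' leSn) cS'.
  by exists S0; rewrite // (leq_trans le0) // ltnW.
exists S => //; split=> // S' cS'; rewrite leqNgt; apply/negP => ltS'.
by apply: minS; exists S'.
Qed.

Lemma sparse_indep_min_cut (T : finType) (e : rel T) :
  simple_graph e -> 7 <= #|T| -> 2 * gsize e <= 3 * #|T| ->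
  has_indep_min_vertex_cut e.
Proof.
move=> [eS eI] T7 m_le; apply: NNPP => no_cut.
(* A smallest cut either has at most one vertex, and is independent, or has at least two, and then
   [S] itself is minimum. *)
have gT : good e setT.
  move=> S C iS S2 sepC.
  have cS : vertex_cut e S by apply/vertex_cutP; exists C.
  have [S0 m0 le0] := vertex_cut_min cS.
  have [S01|S02] := leqP #|S0| 1.
    by apply: no_cut; exists S0; split=> //; apply: independent_card1.
  apply: no_cut; exists S; split=> //; split=> // S' cS'.
  by case: m0 => _ /(_ S' cS'); lia.
by apply/no_cut/cubic_indep_min_cut => //; apply: good_cubic.
Qed.

(** * Connectivity of the Moebius ladder after two deletions *)

(* Orientation of the Moebius ladder on [0, 2k) (a Hamiltonian cycle with its
   long diagonals), where every further vertex points to [0] and [1]. *)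
Definition ladder_arc k (x y : nat) : bool :=
  [|| (y == x.+1) && (y < 2 * k), (x == (2 * k).-1) && (y == 0),
      (y == x + k) && (x < k) | (2 * k <= x) && (y < 2)].

(* [d o] is the colour of the vertex [o] steps after a deleted vertex of the
   Hamiltonian cycle, and [j] is the position of the other deleted vertex. *)
Lemma ladder_offset_const k (d : nat -> bool) j :
  2 <= k -> j < 2 * k ->
  (forall o, 0 < o -> o.+1 < 2 * k -> o != j -> o.+1 != j -> d o = d o.+1) ->
  (forall o, 0 < o -> o < k -> o != j -> o + k != j -> d o = d (o + k)) ->
  forall o o', 0 < o < 2 * k -> 0 < o' < 2 * k -> o != j -> o' != j -> d o = d o'.
Proof.
move=> k2 jk d1 dk.
(* Walking along the cycle keeps the colour as long as [j] is not met. *)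
have run a b : 0 < a -> a <= b -> b < 2 * k -> (b < j) || (j < a) -> d a = d b.
  move=> a0; elim: b => [|b IH] ab bk jab; first by lia.
  have [->//|ltab] := eqVneq a b.+1.
  by rewrite IH; [apply: d1; lia | lia..].
(* A chord bypasses [j]: from [1] to [k + 1] if [j <= k], otherwise from [k - 1] to [2 * k - 1]. *)
have ends : 1 < j -> j < (2 * k).-1 -> d 1 = d (2 * k).-1.
  move=> j1 j2; have [jk'|jk'] := leqP j k.
    by rewrite dk; [apply: run; lia | lia..].
  rewrite (run 1 k.-1); try lia.
  by rewrite dk; [congr (d _); lia | lia..].
move=> o o'; wlog le_oo' : o o' / o <= o' => [IH|] ho ho' oj o'j.
  by case: (leqP o o') => h; [apply: IH | apply/esym/IH => //; lia].
have [|jin] := boolP ((o' < j) || (j < o)); first by apply: run; lia.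
have -> : d o = d 1 by apply/esym/run; lia.
by rewrite ends; [apply/esym/run; lia | lia..].
Qed.

(** This is the 3-connectivity of the ladder in terms of colourings; [s = t] covers a single
    deletion. Rotating the cycle brings [s] to offset [0]. *)
Lemma ladder_const k (c : nat -> bool) s t :
  2 <= k -> s < 2 * k -> t < 2 * k ->
  (forall x y, x < 2 * k -> y < 2 * k -> x \notin [:: s; t] -> y \notin [:: s; t] ->
     ladder_arc k x y -> c x = c y) ->
  forall x y, x < 2 * k -> y < 2 * k -> x \notin [:: s; t] -> y \notin [:: s; t] ->
    c x = c y.
Proof.
move=> k2 sk tk cE x y xk yk.
(* [h o] is the vertex [o] steps after [s], and [pos] inverts it on the cycle. *)
pose h o := if s + o < 2 * k then s + o else s + o - 2 * k.
pose pos z := if s <= z then z - s else z + 2 * k - s.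
have posK z : z < 2 * k -> h (pos z) = z by rewrite /h /pos; do ?case: ifP; lia.
have hE o : 0 < o < 2 * k -> o != pos t -> h o < 2 * k /\ h o \notin [:: s; t].
  by rewrite !inE /h /pos; do ?case: ifP; lia.
have posE z : z < 2 * k -> z \notin [:: s; t] -> (0 < pos z < 2 * k) /\ pos z != pos t.
  by rewrite !inE /pos; do ?case: ifP; lia.
move=> /(posE _ xk)[xp xt] /(posE _ yk)[yp yt].
rewrite -(posK x) // -(posK y) //.
apply: (@ladder_offset_const k (c \o h) (pos t)) => //=; first by rewrite /pos; case: ifP; lia.
  move=> o o0 ok ot o1t.
  have [||h1 h2] := hE o => //; first lia.
  have [||h3 h4] := hE o.+1 => //.
  by apply: cE => //; rewrite /ladder_arc /h; do ?case: ifP; lia.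
move=> o o0 ok ot okt.
have [||h1 h2] := hE o => //; first lia.
have [||h3 h4] := hE (o + k) => //; first lia.
(* Chords are oriented from the lower half to the upper, so after wrapping around this one may point
   either way. *)
have [E|E] : h (o + k) = h o + k \/ h o = h (o + k) + k.
- by rewrite /h; do ?case: ifP; lia.
- by apply: cE => //; apply/or4P; constructor 3; rewrite E eqxx; lia.
by apply/esym/cE => //; apply/or4P; constructor 3; rewrite E eqxx; lia.
Qed.

(** * The extremal graphs *)

Section Ladder.
Variables (k n : nat).
Hypotheses (k3 : 3 <= k) (nk : 2 * k < n <= 2 * k + 2).

Definition ladder : rel 'I_n := fun x y => ladder_arc k x y || ladder_arc k y x.

Lemma ladder_simple : simple_graph ladder.
Proof.
split=> [x y|x]; rewrite /ladder; first exact: orbC.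
by rewrite orbb /ladder_arc; lia.
Qed.

(** Out-degrees are 2 at the [k] tails of chords and at the added vertices, and 1 elsewhere. *)
Lemma gsize_ladder : gsize ladder = 3 * k + 2 * (n - 2 * k).
Proof.
rewrite (@gsize_orientation _ ladder (fun x y => ladder_arc k x y)) //.
- rewrite (eq_bigr (fun x : 'I_n => 1 + ((x < k) || (2 * k <= x)))).
    rewrite -(big_mkord predT (fun x => 1 + ((x < k) || (2 * k <= x)))).
    rewrite (@big_cat_nat _ _ _ k) /=; [|lia..].
    rewrite (@big_cat_nat _ _ _ (2 * k) k n) /=; [|lia..].
    rewrite (@eq_big_nat _ _ _ 0 k _ (fun _ => 2)); last by move=> i; lia.
    rewrite (@eq_big_nat _ _ _ k (2 * k) _ (fun _ => 1)); last by move=> i; lia.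
    rewrite (@eq_big_nat _ _ _ (2 * k) n _ (fun _ => 2)); last by move=> i; lia.
    by rewrite !sum_nat_const_nat; lia.
  move=> x _; have xn := ltn_ord x.
  have two a b (an : a < n) (bn : b < n) : a != b ->
      (forall y, ladder_arc k x y = (y == a) || (y == b)) ->
      #|[set y : 'I_n | ladder_arc k x y]| = 2.
    move=> nab E; have -> : [set y : 'I_n | ladder_arc k x y] = [set Ordinal an; Ordinal bn].
      by apply/setP => y; rewrite !inE E -!val_eqE.
    by rewrite cards2 -val_eqE /= nab.
  have [xk|xk] := ltnP x k.
    rewrite (two x.+1 (x + k)); try lia.
    by move=> y; rewrite /ladder_arc; lia.
  have [xk2|xk2] := leqP (2 * k) x.
    rewrite (two 0 1); try lia.
    by move=> y; rewrite /ladder_arc; lia.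
  have an : (if x.+1 < 2 * k then x.+1 else 0) < n by case: ifP; lia.
  apply/eqP/cards1P; exists (Ordinal an); apply/setP => y.
  by rewrite !inE -val_eqE /= /ladder_arc; case: ifP; lia.
- by move=> x; rewrite /ladder_arc; lia.
by move=> x y; rewrite /ladder_arc; lia.
Qed.

Lemma ladder_good : good ladder setT.
Proof.
move=> S C iS S2 [nC sC nT cl].
have [eS eI] := ladder_simple.
have col x y : x \notin S -> y \notin S -> ladder x y -> (x \in C) = (y \in C).
  move=> xS yS xy; apply/idP/idP => zC.
    by have := cl _ _ zC (in_setT _) xy; rewrite inE (negbTE yS) orbF.
  by rewrite eS in xy; have := cl _ _ zC (in_setT _) xy; rewrite inE (negbTE xS) orbF.
have col_ladder (x y : 'I_n) : x < 2 * k -> y < 2 * k -> x \notin S -> y \notin S ->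
    (x \in C) = (y \in C).
  move=> xk yk xS yS.
  (* [z] is a ladder vertex to delete as a dummy when [S] is empty or contains an added vertex. *)
  have [z [z3 zx zy]] : exists z, [/\ z < 3, z != x & z != y].
    case: (boolP ((0 != x) && (0 != y))) => [/andP[]|]; first by exists 0.
    case: (boolP ((1 != x) && (1 != y))) => [/andP[]|]; first by exists 1.
    by exists 2; split; lia.
  have [p [q [pS qS Spq]]] : exists p q : nat, [/\ (p != x) && (p != y), (q != x) && (q != y) &
      forall w : 'I_n, w \in S -> (w == p :> nat) || (w == q :> nat)].
    have ne (w : 'I_n) : w \in S -> (w != x :> nat) && (w != y :> nat).
      move=> wS; apply/andP; split; apply/eqP => /val_inj E.
        by rewrite -E wS in xS.
      by rewrite -E wS in yS.
    case E: #|S| S2 => [|[|[|m]]] // _.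
    - exists z, z; rewrite zx zy; split=> // w.
      by move/eqP: E; rewrite cards_eq0 => /eqP ->; rewrite inE.
    - move/eqP/cards1P: E => [p E]; exists p, p.
      rewrite ne ?E ?set11 //; split=> // w /set1P ->.
      by rewrite eqxx.
    move/eqP/cards2P: E => [p [q [_ E]]]; exists p, q.
    rewrite !ne ?E ?set21 ?set22 //; split=> // w /set2P[] ->; by rewrite eqxx ?orbT.
  pose s := if p < 2 * k then p else z; pose t := if q < 2 * k then q else z.
  have SS (w : 'I_n) : w < 2 * k -> (w : nat) \notin [:: s; t] -> w \notin S.
    by move=> wk; apply: contra => /Spq; rewrite !inE /s /t; do ?case: ifP; lia.
  (* The default [false] is harmless: only vertices below [2 * k], hence below [n], are compared. *)
  pose c i := if insub i is Some w then w \in C else false.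
  have cE (w : 'I_n) : c w = (w \in C) by rewrite /c valK.
  have [sk sx sy] : [/\ s < 2 * k, s != x & s != y].
    by case/andP: pS => *; rewrite /s; case: ifP; split=> //; lia.
  have [tk tx ty] : [/\ t < 2 * k, t != x & t != y].
    by case/andP: qS => *; rewrite /t; case: ifP; split=> //; lia.
  have xst : (x : nat) \notin [:: s; t] by rewrite !inE; lia.
  have yst : (y : nat) \notin [:: s; t] by rewrite !inE; lia.
  rewrite -!cE; apply: (ladder_const (ltnW k3) sk tk _ xk yk xst yst).
  move=> a b ak bk aS bS ab.
  have an : a < n by lia.
  have bn : b < n by lia.
  rewrite -[a]/(val (Ordinal an)) -[b]/(val (Ordinal bn)) !cE.
  by apply: col; [apply: SS | apply: SS | rewrite /ladder /= ab].
(* An added vertex is joined to [0] and [1]; these are adjacent, so the independent [S] misses one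
   of them, which lies on the same side. *)
have rep (x : 'I_n) : x \notin S ->
    exists y : 'I_n, [/\ y < 2 * k, y \notin S & (x \in C) = (y \in C)].
  move=> xS; have [xk|xk] := ltnP x (2 * k); first by exists x.
  have n0 : 0 < n by lia.
  have n1 : 1 < n by lia.
  have [S0|S0] := boolP (Ordinal n0 \in S); last first.
    exists (Ordinal n0); split=> //=; first lia.
    by apply: col => //; rewrite /ladder /ladder_arc /=; lia.
  have S1 : Ordinal n1 \notin S.
    apply/negP => /(iS _ _ S0).
    by rewrite /ladder /ladder_arc /=; lia.
  exists (Ordinal n1); split=> //=; first lia.
  by apply: col => //; rewrite /ladder /ladder_arc /=; lia.
case/set0Pn: nC => x xC; case/subsetPn: nT => y _.
rewrite inE negb_or => /andP[yC yS].
have xS : x \notin S by have := subsetP sC _ xC; rewrite inE => /andP[].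
have [x' [x'k x'S Ex]] := rep _ xS; have [y' [y'k y'S Ey]] := rep _ yS.
by rewrite Ey -(col_ladder x' y') // -Ex xC in yC.
Qed.

(** An unreachable pair would make the empty set an independent cut. *)
Lemma ladder_connected : gconnected ladder.
Proof.
move=> x y; have [//|nxy] := boolP (connect ladder x y).
have /vertex_cutP[C sepC] : vertex_cut ladder set0.
  exists x, y; rewrite !inE; split=> //; apply: contra nxy.
  by apply: connect_sub => a b /and3P[ab _ _]; apply: connect1.
by case: (ladder_good _ _ sepC); rewrite ?cards0 // => a; rewrite inE.
Qed.

Lemma ladder_no_indep_min_cut : ~ has_indep_min_vertex_cut ladder.
Proof.
move=> [S [[cS minS] iS]].
have n0 : 0 < n by lia.
have n1 : 1 < n by lia.
have n2 : 2 < n by lia.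
have nv : 2 * k < n by lia.
case/vertex_cutP: (cS) => C; apply: ladder_good => //.
(* The vertices [0] and [1] cut off the added vertex [2 * k], so a minimum cut has at most two
   vertices. *)
apply: leq_trans (minS [set Ordinal n0; Ordinal n1] _) _; last by rewrite cards2.
apply/vertex_cutP; exists [set Ordinal nv]; split.
- by apply/set0Pn; exists (Ordinal nv); rewrite inE.
- by rewrite sub1set !inE -!val_eqE /=; lia.
- by apply/subsetPn; exists (Ordinal n2); rewrite // !inE -!val_eqE /=; lia.
by move=> a b /set1P-> _; rewrite !inE -!val_eqE /= /ladder /ladder_arc /=; lia.
Qed.

End Ladder.

Theorem theorem3 (n : nat) (hn : 7 <= n) :
  (forall (T : finType) (e : rel T),
      simple_graph e -> #|T| = n -> gconnected e ->
      gsize e <= (3 * n) %/ 2 ->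
      has_indep_min_vertex_cut e)
  /\
  (exists e : rel 'I_n,
      [/\ simple_graph e, gconnected e,
          gsize e = (3 * n) %/ 2 + 1
        & ~ has_indep_min_vertex_cut e]).
Proof.
split=> [T e eG Tn _ m_le|]; first by apply: sparse_indep_min_cut; rewrite ?Tn //; lia.
(* This choice of [k] leaves one added vertex for odd [n] and two for even [n]. *)
have k3 : 3 <= n.-1 %/ 2 by lia.
have nk : 2 * (n.-1 %/ 2) < n <= 2 * (n.-1 %/ 2) + 2 by lia.
exists (@ladder (n.-1 %/ 2) n); split.
- exact: ladder_simple.
- exact: ladder_connected.
- by rewrite gsize_ladder //; lia.
exact: ladder_no_indep_min_cut.
Qed.
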